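(* Let $G$ be a finitely generated indicable group, i.e. a finitely generated group that admits an epimorphism onto $\mathbb{Z}$. Then for every integer $n\geq \max\{2,\operatorname{rank}(G)\}$ the Nielsen graph $N_n(G)$ is nonamenable.
   Context: $\operatorname{rank}(G)$ is the minimal number of generators of $G$. Elementary Nielsen moves on $G^n$ are, for $1\le i,j\le n$, $i\ne j$: $R_{ij}^{\pm}$, replacing the entry $g_i$ by $g_ig_j^{\pm1}$; $L_{ij}^{\pm}$, replacing $g_i$ by $g_j^{\pm1}g_i$; and, for $1\le j\le n$, $I_j$, replacing $g_j$ by $g_j^{-1}$; all other entries are unchanged. For $n\ge \operatorname{rank}(G)$, the Nielsen graph $N_n(G)$ has as vertex set all $n$-tuples $(g_1,\dots,g_n)\in G^n$ with $\langle g_1,\dots,g_n\rangle=G$; from each vertex there is one edge for each elementary Nielsen move, joining the vertex to its image under the move (loops and multiple edges allowed; orientation disregarded, since the set of moves is symmetric). A locally finite connected graph $X$ of uniformly bounded degree is amenable if either $X$ is finite or $h(X):=\inf_{S}\frac{|\partial_X(S)|}{|S|}=0$, where the infimum is over all finite nonempty $S\subset V(X)$ and $\partial_X(S)$ is the set of edges connecting $S$ to its complement. A graph with several connected components is amenable if at least one of its connected components is amenable. Nonamenable means not amenable (so every connected component is nonamenable). *)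

(* Defs.v *)
From HB Require Import structures.
From mathcomp Require Import all_boot all_order all_algebra finmap.
From mathcomp Require Import all_classical all_reals.
From Stdlib Require Import Relation_Operators.

Set Implicit Arguments.
Unset Strict Implicit.
Unset Printing Implicit Defensive.

Import Order.TTheory GRing.Theory Num.Theory.

Local Open Scope classical_set_scope.

(* Multigraphs of uniformly bounded degree, in Serre's formalism: an edge is a
   pair {d, rev d} of mutually reverse darts, and it joins [source d] to
   [target d].  A dart may be its own reverse, but it is then a loop. *)
Record multigraph := Multigraph {
  vertex : choiceType;
  dart : choiceType;
  source : dart -> vertex;
  target : dart -> vertex;
  rev : dart -> dart;
  revK : involutive rev;
  source_rev : forall d, source (rev d) = target d;
  bounded_degree : exists D : nat, forall v : vertex, exists s : {fset dart},
    (#|` s| <= D)%N /\ forall d, source d = v -> d \in s }.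

Section Amenability.
Variable X : multigraph.
Implicit Types (S : {fset vertex X}) (C : set (vertex X)).

Definition adjacent (v w : vertex X) : Prop :=
  exists d : dart X, source d = v /\ target d = w.

Definition component (v : vertex X) : set (vertex X) :=
  [set w | clos_refl_trans _ adjacent v w].

(* An edge between S and its complement has exactly one dart with source in S,
   so this set is in bijection with the set of such edges. *)
Definition boundary S : set (dart X) :=
  [set d | source d \in S /\ target d \notin S].

Lemma boundary_finite S : finite_set (boundary S).
Proof.
case: (bounded_degree X) => D star.
have [f fP] : {f : vertex X -> {fset dart X} |
    forall v d, source d = v -> d \in f v}.
  apply/cid; suff /choice [f fP] : forall v, exists s : {fset dart X},
    forall d, source d = v -> d \in s by exists f.
  by move=> v; have [s [_ sP]] := star v; exists s.
apply: (@sub_finite_set _ _ [set` \bigcup_(v <- S) f v]%fset) => //.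
move=> d [dS _] /=; apply/bigfcupP; exists (source d); last exact: fP.
by rewrite dS.
Qed.

(* The edge set of a connected component C has the same boundary as X at every
   subset of C, so this is h of the component C viewed as a graph. *)
Definition isoperimetric (R : realType) C : R :=
  inf [set r : R | exists S : {fset vertex X},
    [/\ S != fset0, [set` S] `<=` C
      & r = (#|` fset_set (boundary S)|%:R / #|` S|%:R)%R]].

Definition amenable (R : realType) : Prop :=
  exists v : vertex X,
    finite_set (component v) \/ isoperimetric R (component v) = 0%R.

Definition nonamenable (R : realType) : Prop := ~ amenable R.

End Amenability.

Section Groups.
Variable G : groupType.

Definition subgroup (H : set G) : Prop :=
  [/\ H 1%g, forall x y, H x -> H y -> H (x * y)%g & forall x, H x -> H x^-1%g].

Definition generates (n : nat) (x : {ffun 'I_n -> G}) : Prop :=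
  smallest subgroup (range x) = setT.

Definition finitely_generated : Prop :=
  exists n : nat, exists x : {ffun 'I_n -> G}, generates x.

Lemma finitely_generated_asbool : finitely_generated ->
  exists n : nat, `[< exists x : {ffun 'I_n -> G}, generates x >].
Proof. by case=> n ex; exists n; apply/asboolP. Qed.

Definition rank (fgG : finitely_generated) : nat :=
  ex_minn (finitely_generated_asbool fgG).

Definition indicable : Prop :=
  exists phi : G -> int,
    (forall x y, phi (x * y)%g = (phi x + phi y)%R) /\
    (forall z : int, exists x, phi x = z).

End Groups.

Definition distinct_pair (n : nat) := {p : 'I_n * 'I_n | p.1 != p.2}.

(* For p = (i, j), [RMove p false] is R_ij^+, [RMove p true] is R_ij^-, and
   similarly for [LMove]. *)
Inductive nielsen_move (n : nat) :=
  | RMove of distinct_pair n & bool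
  | LMove of distinct_pair n & bool
  | IMove of 'I_n.

Section NielsenMoveFinite.
Variable n : nat.
Local Notation code := ((distinct_pair n * bool) + (distinct_pair n * bool)
  + 'I_n)%type.

Definition code_of_move (m : nielsen_move n) : code :=
  match m with
  | RMove p s => inl (inl (p, s))
  | LMove p s => inl (inr (p, s))
  | IMove j => inr j
  end.

Definition move_of_code (c : code) : nielsen_move n :=
  match c with
  | inl (inl (p, s)) => RMove p s
  | inl (inr (p, s)) => LMove p s
  | inr j => IMove j
  end.

Lemma code_of_moveK : cancel code_of_move move_of_code.
Proof. by case. Qed.

HB.instance Definition _ := Finite.copy (nielsen_move n) (can_type code_of_moveK).

End NielsenMoveFinite.

Section NielsenGraph.
Variables (G : groupType) (n : nat).
Implicit Types (x : {ffun 'I_n -> G}) (m : nielsen_move n).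

Definition signed (s : bool) (g : G) : G := if s then g^-1%g else g.

Definition nielsen_apply m x : {ffun 'I_n -> G} :=
  match m with
  | RMove p s => [ffun k => if k == (val p).1
                            then (x (val p).1 * signed s (x (val p).2))%g
                            else x k]
  | LMove p s => [ffun k => if k == (val p).1
                            then (signed s (x (val p).2) * x (val p).1)%g
                            else x k]
  | IMove j => [ffun k => if k == j then (x j)^-1%g else x k]
  end.

Definition nielsen_inv m : nielsen_move n :=
  match m with
  | RMove p s => RMove p (~~ s)
  | LMove p s => LMove p (~~ s)
  | IMove j => IMove j
  end.

Lemma nielsen_invK : involutive nielsen_inv.
Proof. by case=> //= p s; rewrite negbK. Qed.

Lemma signedN s (g : G) : signed (~~ s) g = (signed s g)^-1%g.
Proof. by case: s; rewrite /= ?invgK. Qed.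

Lemma nielsen_applyK m : cancel (nielsen_apply m) (nielsen_apply (nielsen_inv m)).
Proof.
move=> x; apply/ffunP => k.
case: m => [[[i j] /= ij] s|[[i j] /= ij] s|j] /=; rewrite !ffunE /= ?eqxx.
- by rewrite (eq_sym j) (negbTE ij) signedN mulgK; case: eqP => [->|].
- by rewrite (eq_sym j) (negbTE ij) signedN mulKg; case: eqP => [->|].
- by rewrite invgK; case: eqP => [->|].
Qed.

Lemma nielsen_apply_subgroup m x (H : set G) :
  subgroup H -> (forall k, H (x k)) -> forall k, H (nielsen_apply m x k).
Proof.
move=> [_ HM HV] Hx k.
have Hs s j : H (signed s (x j)) by case: s => /=; [apply: HV|].
by case: m => [p s|p s|j] /=; rewrite ffunE; case: ifP => // _;
  do ?[apply: HM|apply: HV].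
Qed.

Lemma nielsen_apply_generates m x : generates x -> generates (nielsen_apply m x).
Proof.
rewrite /generates => gx; apply/seteqP; split=> // g _ H [sH rH].
have : smallest (@subgroup G) (range x) g by rewrite gx.
apply; split=> // _ [k _ <-]; rewrite -(nielsen_applyK m x).
by apply: nielsen_apply_subgroup => // j; apply: rH; exists j.
Qed.

Definition generating_tuple : choiceType :=
  {x : {ffun 'I_n -> G} | `[< generates x >]}.

Lemma nielsen_act_proof m (v : generating_tuple) :
  `[< generates (nielsen_apply m (val v)) >].
Proof. by apply/asboolP/nielsen_apply_generates/asboolP/(valP v). Qed.

Definition nielsen_act m (v : generating_tuple) : generating_tuple :=
  Sub (nielsen_apply m (val v)) (nielsen_act_proof m v).

Definition nielsen_dart : choiceType := (generating_tuple * nielsen_move n)%type.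

Definition nielsen_rev (d : nielsen_dart) : nielsen_dart :=
  (nielsen_act d.2 d.1, nielsen_inv d.2).

Lemma nielsen_revK : involutive nielsen_rev.
Proof.
move=> [v m]; rewrite /nielsen_rev /= nielsen_invK; congr (_, _).
by apply: val_inj; rewrite /= nielsen_applyK.
Qed.

Lemma nielsen_bounded_degree : exists D : nat, forall v : generating_tuple,
  exists s : {fset nielsen_dart},
    (#|` s| <= D)%N /\ forall d : nielsen_dart, d.1 = v -> d \in s.
Proof.
exists #|{: nielsen_move n}| => v.
exists [fset ((v, m) : nielsen_dart) | m in {: nielsen_move n}]%fset; split.
  by rewrite (leq_trans (leq_imfset_card _ _ _)) //= cardE.
by move=> [w m] /= ->; apply/imfsetP; exists m.
Qed.

Definition nielsen_graph : multigraph :=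
  @Multigraph generating_tuple nielsen_dart
    (fun d => d.1) (fun d => nielsen_act d.2 d.1) nielsen_rev
    nielsen_revK (fun=> erefl) nielsen_bounded_degree.

End NielsenGraph.

(* Main.v *)
(* Let [a = (phi x_1, ..., phi x_n)] be the image in [int ^ n] of a generating
   tuple [x] under an epimorphism [phi : G -> Z]; then [a] is not zero.  Fix
   [i <> j] and set [A = {|a_i| <= |a_j|, a_j <> 0}] and
   [B = {|a_j| <= |a_i|, a_i <> 0}].  The cubes of [R_ij^+] and of [R_ij^-] map
   [A] into the parts [a_i a_j > 0] and [a_i a_j < 0] of [B], and symmetrically
   for [R_ji].  A move takes at most [|boundary S|] elements of a finite set [S]
   out of [S], so [2 |A| <= |B| + 6 |boundary S|] and
   [2 |B| <= |A| + 6 |boundary S|] inside [S], hence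
   [|A| + |B| <= 12 |boundary S|].  Since [a <> 0], the sets [A] and [B] for the
   pairs [(k, k')], with [k'] some index other than [k], cover [S]; therefore
   [|S| <= 12 n |boundary S|]. *)

Require Import Defs.
From mathcomp Require Import all_boot all_order all_algebra.
From mathcomp Require Import all_classical all_reals.
From mathcomp Require Import finmap zify.
From Stdlib Require Import Relation_Operators.

Set Implicit Arguments.
Unset Strict Implicit.
Unset Printing Implicit Defensive.

Import Order.TTheory GRing.Theory Num.Theory.

Local Open Scope classical_set_scope.

Lemma leq_card_inj_fset (T U : choiceType) (f : T -> U)
    (A : {fset T}) (B : {fset U}) :
  injective f -> (forall x, x \in A -> f x \in B) -> (#|` A| <= #|` B|)%N.
Proof.
move=> f_inj fAB; have <- : #|` [fset f x | x in A]%fset| = #|` A|.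
  by rewrite card_imfset.
apply/fsubset_leq_card/fsubsetP => _ /imfsetP[x xA ->]; exact: fAB.
Qed.

Section NielsenWords.
Local Open Scope fset_scope.
Variables (G : groupType) (n : nat).
Implicit Types (x y : generating_tuple G n) (w : seq (nielsen_move n)).
Implicit Types (S : {fset generating_tuple G n}).
Implicit Types (P Q : pred (generating_tuple G n)).

Definition word_act w x := foldl (fun y m => nielsen_act m y) x w.

Lemma nielsen_act_inj m : injective (@nielsen_act G n m).
Proof.
move=> x y /(congr1 val) /= /(can_inj (@nielsen_applyK G n m)); exact: val_inj.
Qed.

Lemma word_act_inj w : injective (word_act w).
Proof. by elim: w => //= m w IHw x y /IHw /nielsen_act_inj. Qed.

Definition boundary_size S := #|` fset_set (@boundary (nielsen_graph G n) S)|.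

(** Union bound over the letters of the word: a point of [S] carried out of [S] either leaves at the
    first move or is sent into [S] and leaves under the remaining word. *)
Lemma word_exit_le w S :
  (#|` [fset x in S | word_act w x \notin S]| <= size w * boundary_size S)%N.
Proof.
elim: w => [|m w IHw] /=.
  rewrite mul0n leqn0 cardfs_eq0; apply/eqP/fsetP => x.
  by rewrite !inE /=; case: (x \in S).
pose E := [fset x in S | nielsen_act m x \notin S]%fset.
pose F := [fset x in S | (nielsen_act m x \in S)
                         && (word_act w (nielsen_act m x) \notin S)]%fset.
have EF : ([fset x in S | word_act w (nielsen_act m x) \notin S]
            `<=` E `|` F)%fset.
  apply/fsubsetP => x; rewrite !inE /= => /andP[-> ->].
  by rewrite andbT; case: (_ \in S).
(* A point leaving at the first move [m] is the source of its own boundary dart [(x, m)]. *)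
have leE : (#|` E| <= boundary_size S)%N.
  have injE : injective (fun x => (x, m) : nielsen_dart G n) by move=> ? ? [].
  apply: leq_card_inj_fset injE _ => x; rewrite !inE /= => /andP[xS mxS].
  rewrite in_fset_set; last exact: (@boundary_finite (nielsen_graph G n)).
  exact/mem_set.
have leF : (#|` F| <= size w * boundary_size S)%N.
  apply: leq_trans IHw; apply: leq_card_inj_fset (@nielsen_act_inj m) _ => x.
  by rewrite !inE /= => /andP[_].
rewrite mulSn (leq_trans (fsubset_leq_card EF)) // cardfsU.
by rewrite (leq_trans (leq_subr _ _)) // leq_add.
Qed.

(** The word acts injectively, so the points that it keeps in [S] are counted by [Q]; the others are
    counted by [word_exit_le]. *)
Lemma card_word_le w S P Q : (forall x, P x -> Q (word_act w x)) ->
  (#|` [fset x in S | P x]| <=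
     #|` [fset x in S | Q x]| + size w * boundary_size S)%N.
Proof.
move=> PQ; pose stay := [fset x in S | P x && (word_act w x \in S)]%fset.
have sub : ([fset x in S | P x]
             `<=` stay `|` [fset x in S | word_act w x \notin S])%fset.
  apply/fsubsetP => x; rewrite !inE /= => /andP[-> ->].
  by case: (_ \in S).
rewrite (leq_trans (fsubset_leq_card sub)) // cardfsU.
rewrite (leq_trans (leq_subr _ _)) // leq_add ?word_exit_le //.
apply: leq_card_inj_fset (@word_act_inj w) _ => x.
by rewrite !inE /= => /and3P[_ /PQ -> ->].
Qed.

End NielsenWords.

Section Expansion.
Local Open Scope fset_scope.
Variables (G : groupType) (n : nat) (phi : G -> int).
Hypothesis phiM : forall g h, phi (g * h)%g = (phi g + phi h)%R.
Implicit Types (x : generating_tuple G n) (p : distinct_pair n).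
Implicit Types (S : {fset generating_tuple G n}).

Lemma additive1 : phi 1%g = 0%R.
Proof. by have := phiM 1 1; rewrite mulg1; lia. Qed.

Lemma additiveV g : phi g^-1%g = (- phi g)%R.
Proof. by have := phiM g g^-1; rewrite mulgV additive1; lia. Qed.

(** This cuts out the set $A$ of the pair $(i, j)$; [dominated j i] cuts out $B$. *)
Definition dominated (i j : 'I_n) x :=
  (`|phi (val x i)| <= `|phi (val x j)|)%R && (phi (val x j) != 0%R).

Lemma RMove_cube p (s : bool) x (y := word_act (nseq 3 (RMove p s)) x) :
  phi (val y (val p).1) = (phi (val x (val p).1)
     + (if s then -3 else 3) * phi (val x (val p).2))%R
  /\ val y (val p).2 = val x (val p).2.
Proof.
rewrite {}/y /word_act /=; case: p => [[i j] /= ij].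
rewrite !ffunE /= !eqxx !(eq_sym j) (negbTE ij) !phiM; split=> //.
by case: s; rewrite /= ?additiveV; lia.
Qed.

Lemma card_dominated_le (i j : 'I_n) S : i != j ->
  (2 * #|` [fset x in S | dominated i j x]| <=
     #|` [fset x in S | dominated j i x]| + 6 * boundary_size S)%N.
Proof.
move=> ij; pose p : distinct_pair n := exist _ (i, j) ij.
(* The two disjoint parts of $B$, by the sign of $a_i a_j$. Each receives a copy of $A$ at a cost of
   3 boundaries, whence the constant 6. *)
pose Q (s : bool) x := dominated j i x &&
  (if s then phi (val x i) * phi (val x j) < 0
   else 0 < phi (val x i) * phi (val x j))%R.
have le s := @card_word_le _ _ (nseq 3 (RMove p s)) S (dominated i j) (Q s).
have lep s : (#|` [fset x in S | dominated i j x]| <=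
    #|` [fset x in S | Q s x]| + 3 * boundary_size S)%N.
  apply: le => x; rewrite /Q /dominated.
  have [-> ->] := RMove_cube p s x; rewrite /=.
  move: (phi (val x i)) (phi (val x j)) => a b.
  (* If $|a| \le |b|$ and $b \ne 0$, then $a \pm 3b$ has the sign of $\pm b$ and absolute value at
     least $2|b|$. *)
  by case: s => /andP[ab b0]; apply/andP; split; [lia|nia|lia|nia].
have := leq_add (lep false) (lep true).
have QI : [fset x in S | Q false x]%fset `&` [fset x in S | Q true x]%fset
    = fset0 :> {fset _}.
  apply/fsetP => x; rewrite !inE /Q /=; apply/negP.
  by move=> /andP[/and3P[_ _ +] /and3P[_ _]]; lia.
have sub : ([fset x in S | Q false x] `|` [fset x in S | Q true x]
    `<=` [fset x in S | dominated j i x])%fset.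
  apply/fsubsetP => x; rewrite !inE /Q /=.
  by case/orP => /and3P[-> ->].
have := fsubset_leq_card sub; rewrite cardfsU QI cardfs0; lia.
Qed.

Hypothesis phi_surj : forall z : int, exists g, phi g = z.

(** Otherwise the kernel of [phi] is a subgroup containing all entries, hence all of [G], although
    [phi] takes the value 1. *)
Lemma generating_tuple_neq0 x : exists k, phi (val x k) != 0%R.
Proof.
apply: contrapT => /forallNP x0; have [g g1] := phi_surj 1.
have /asboolP gx := valP x.
have /(_ [set h | phi h = 0%R]) : smallest (@subgroup G) (range (val x)) g.
  by rewrite [smallest _ _]gx.
rewrite /= g1 => H0; suff: (1 = 0 :> int)%R by [].
apply: H0; split.
  split=> /= [|h k h0 k0|h h0]; first exact: additive1.
    by rewrite phiM h0 k0.
  by rewrite additiveV h0.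
by move=> _ [k _ <-] /=; apply/eqP/negP => /negP /x0.
Qed.

Lemma other_index (k : 'I_n) : (1 < n)%N -> exists l, k != l.
Proof.
move=> n1; have n0 := ltnW n1.
have [k0|k0] := eqVneq (val k) 0%N.
  by exists (Ordinal n1); rewrite -val_eqE /= k0.
by exists (Ordinal n0); rewrite -val_eqE.
Qed.

Lemma nielsen_expansion S : (1 < n)%N ->
  (#|` S| <= 12 * n * boundary_size S)%N.
Proof.
move=> n1.
have /choice[o ko] : forall k : 'I_n, exists l, k != l.
  by move=> k; apply: other_index.
pose T k := [fset x in S | dominated k (o k) x || dominated (o k) k x]%fset.
have leT k : (#|` T k| <= 12 * boundary_size S)%N.
  have ok : o k != k by rewrite eq_sym.
  have := card_dominated_le S (ko k); have := card_dominated_le S ok.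
  have sub : (T k `<=` [fset x in S | dominated k (o k) x]
      `|` [fset x in S | dominated (o k) k x])%fset.
    apply/fsubsetP => x; rewrite !inE /=.
    by case/andP=> ->.
  have := fsubset_leq_card sub; rewrite cardfsU; lia.
have cover : (S `<=` \bigcup_(k <- enum 'I_n) T k)%fset.
  apply/fsubsetP => x xS; have [k xk] := generating_tuple_neq0 x.
  apply/bigfcupP; exists k; first by rewrite mem_enum.
  (* Since $a_k \ne 0$, the larger in absolute value of $a_k$ and $a_{o(k)}$ is nonzero, so one of
     the two dominations holds. *)
  rewrite !inE /= xS /dominated; lia.
rewrite (leq_trans (fsubset_leq_card cover)) //.
suff le_size (s : seq 'I_n) :
    (#|` \bigcup_(k <- s) T k|%fset <= 12 * size s * boundary_size S)%N.
  by have := le_size (enum 'I_n); rewrite size_enum_ord.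
elim: s => [|k s IHs]; first by rewrite big_nil cardfs0.
rewrite big_cons cardfsU mulnS mulnDl (leq_trans (leq_subr _ _)) //.
exact: leq_add (leT k) IHs.
Qed.

End Expansion.

Theorem theorem1p1 (R : realType) (G : groupType) (fgG : finitely_generated G)
    (indG : indicable G) (n : nat) (hn : (maxn 2 (rank fgG) <= n)%N) :
  nonamenable (nielsen_graph G n) R.
Proof.
have n1 : (1 < n)%N by apply: leq_trans hn; rewrite leq_maxl.
have [phi [phiM phi_surj]] := indG.
have expand := fun S => nielsen_expansion phiM phi_surj S n1.
move=> [v [fin|]].
  (* A finite component has empty boundary, so the expansion bound would force it to be empty. *)
  pose C := fset_set (component v).
  have inC w : w \in C <-> component v w.
    by rewrite in_fset_set //; split=> [/set_mem|/mem_set].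
  have vC : v \in C by apply/inC; apply: rt_refl.
  have : (0 < #|` C|)%N by rewrite cardfs_gt0; apply/fset0Pn; exists v.
  have := expand C; rewrite /boundary_size.
  suff -> : boundary C = set0 by rewrite fset_set0 cardfs0 muln0 leqNgt => /negP.
  apply/seteqP; split=> // d [/inC vd /negP[]]; apply/inC.
  apply: rt_trans vd _.
  by apply: rt_step; exists d.
pose c : R := ((12 * n)%:R^-1)%R.
have c0 : (0 < c)%R by rewrite invr_gt0 ltr0n; lia.
suff le_c : (c <= isoperimetric R (component v))%R.
  by move=> h0; move: le_c; rewrite h0 leNgt c0.
apply: lb_le_inf.
  (* The set of ratios must be nonempty, as [inf] of the empty set is 0 by default; the singleton of
     [v] provides a ratio. *)
  exists (#|` fset_set (boundary [fset v]%fset)|%:R / #|` [fset v]%fset|%:R)%R.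
  exists [fset v]%fset; split=> //.
    by apply/fset0Pn; exists v; rewrite inE.
  by move=> w /=; rewrite inE => /eqP ->; apply: rt_refl.
move=> _ [S [S0 _ ->]].
have S_gt0 : (0 < #|` S|)%N by rewrite cardfs_gt0.
rewrite ler_pdivlMr ?ltr0n // ler_pdivrMl ?ltr0n; last by lia.
by rewrite -natrM ler_nat; apply: expand.
Qed.
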